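(* Let $V,W\subset X$ be subspaces, $P$ the orthogonal projection of $X$ onto $W$, $p=\dim V$, and $S\subset V$ a Lebesgue measurable set. (i) In the real case, $|P(S)|_p=|S|_p\cos\Theta_{V,W}$. (ii) In the complex case, $|P(S)|_{2p}=|S|_{2p}\cos^2\Theta_{V,W}$.
   Context: $X$ is an $n$-dimensional vector space over $\mathbb{R}$ (real case) or $\mathbb{C}$ (complex case) with an inner product $\langle\cdot,\cdot\rangle$ (Hermitian in the complex case, conjugate-linear in the left entry). Subspaces and dimensions are over the same field. $|\cdot|_k$ denotes $k$-dimensional Lebesgue measure; in the complex case it is taken in the underlying real spaces $V_{\mathbb{R}}$, $W_{\mathbb{R}}$ (with twice the complex dimension and inner product $\operatorname{Re}\langle\cdot,\cdot\rangle$). $|\cdot|_k=0$ for sets contained in a real subspace of dimension less than $k$. Principal angles: for nonzero subspaces $V,W\subset X$, with $p=\dim V$, $q=\dim W$, $m=\min\{p,q\}$, there are orthonormal bases $(e_1,\dots,e_p)$ of $V$ and $(f_1,\dots,f_q)$ of $W$ and uniquely determined numbers $0\le\theta_1\le\dots\le\theta_m\le\frac{\pi}{2}$ (the principal angles) such that $\langle e_i,f_j\rangle=\delta_{ij}\cos\theta_i$ (equal to $0$ whenever $i\neq j$). Grassmann angle: for nonzero subspaces $V,W\subset X$ with principal angles $\theta_1,\dots,\theta_m$, the Grassmann angle $\Theta_{V,W}\in[0,\frac{\pi}{2}]$ of $V$ with $W$ is $\Theta_{V,W}=\arccos(\cos\theta_1\cdots\cos\theta_m)$ if $\dim V\le\dim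 W$, and $\Theta_{V,W}=\frac{\pi}{2}$ if $\dim V>\dim W$. Also $\Theta_{\{0\},\{0\}}=\Theta_{\{0\},V}=0$ and $\Theta_{V,\{0\}}=\frac{\pi}{2}$ for $V\ne\{0\}$. *)

(* Defs.v *)
From HB Require Import structures.
From mathcomp Require Import all_boot all_order all_algebra.
From mathcomp Require Import sesquilinear.
From mathcomp Require Import complex.
From mathcomp Require Import all_classical all_reals all_analysis.

Set Implicit Arguments.
Unset Strict Implicit.
Unset Printing Implicit Defensive.

Import Order.TTheory GRing.Theory Num.Theory.
Local Open Scope classical_set_scope.
Local Open Scope ring_scope.

Section LebesgueTuple.
Context {R : realType}.
Local Notation Rtuple R k := (k.-tuple (measurableTypeR R)).

Definition cons_pair k (x : measurableTypeR R * Rtuple R k) : Rtuple R k.+1 :=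
  [tuple of x.1 :: x.2].

Lemma measurable_cons_pair k : measurable_fun [set: _] (@cons_pair k).
Proof. exact: (measurable_cons measurable_fst measurable_snd). Qed.

Section step.
Variables (k : nat) (mu : {sigma_finite_measure set (Rtuple R k) -> \bar R}).

Definition lebesgue_step : set (Rtuple R k.+1) -> \bar R :=
  pushforward (lebesgue_measure \x mu)%E (@cons_pair k).

Let pf : {measure set (Rtuple R k.+1) -> \bar R} :=
  measure_function_pushforward__canonical__measure_function_Measure
    (lebesgue_measure \x mu)%E (@measurable_cons_pair k).

HB.instance Definition _ := isMeasure.Build _ _ _ lebesgue_step
  (measure0 pf) (measure_ge0 pf) (@measure_semi_sigma_additive _ _ _ pf).

Let lebesgue_step_sigma_finite : sigma_finite setT lebesgue_step.
Proof.
have /sigma_finiteP[F [TF ndF Foo]] := sigma_finiteT (@lebesgue_measure R).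
have /sigma_finiteP[G [TG ndG Goo]] := sigma_finiteT mu.
pose uncons (t : Rtuple R k.+1) : measurableTypeR R * Rtuple R k :=
  (thead t, [tuple of behead t]).
have consK : cancel (@cons_pair k) uncons.
  by case=> x t; rewrite /uncons /cons_pair theadE; congr pair; apply: val_inj.
have munc : measurable_fun setT uncons.
  apply/measurable_fun_pairP; split.
    exact: measurable_tnth.
  exact: measurable_behead.
exists (fun n => uncons @^-1` (F n `*` G n)).
  rewrite -preimage_bigcup -[LHS](preimage_setT uncons); congr preimage.
  apply/seteqP; split=> // -[x y] _.
  have [n _ Fnx] : (\bigcup_n F n) x by rewrite -TF.
  have [k' _ Gky] : (\bigcup_n G n) y by rewrite -TG.
  exists (maxn n k') => //; split=> /=.
    by move: x Fnx; exact/subsetPset/ndF/leq_maxl.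
  by move: y Gky; exact/subsetPset/ndG/leq_maxr.
move=> n; have [mF Fn] := Foo n; have [mG Gn] := Goo n; split.
  by rewrite -[X in measurable X]setTI; apply: munc => //; exact: measurableX.
rewrite /lebesgue_step /pushforward -comp_preimage.
rewrite (_ : uncons \o _ = idfun); last exact/funext.
by rewrite preimage_id product_measure1E// lte_mul_pinfty// ge0_fin_numE.
Qed.

HB.instance Definition _ := Measure_isSigmaFinite.Build _ _ _ lebesgue_step
  lebesgue_step_sigma_finite.

End step.

(* Product Lebesgue measure on the Borel sets of R^k; R^0 has one point, of
   mass 1. *)
Fixpoint borel_lebesgue k : {sigma_finite_measure set (Rtuple R k) -> \bar R} :=
  match k with
  | 0 => \d_([tuple] : Rtuple R 0)
  | k.+1 => lebesgue_step (borel_lebesgue k)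
  end.

(* A total set function: the outer measure of borel_lebesgue k, whose
   restriction to the Caratheodory-measurable sets is the complete Lebesgue
   measure. *)
Definition lebesgue k : set (Rtuple R k) -> \bar R :=
  @completed_measure_extension _ _ _ (borel_lebesgue k).

Definition lebesgue_measurable k (A : set (Rtuple R k)) : Prop :=
  (borel_lebesgue k)^*%mu.-cara.-measurable A.

End LebesgueTuple.

Section Realification.
Context {R : realType}.
Import VectorInternalTheory.
Variable X : vectType R[i].

(* The carrier of X with scalars restricted to R. *)
Definition realification : Type := X.

HB.instance Definition _ := GRing.Zmodule.on realification.

Let scale (a : R) (x : realification) : realification := (a%:C)%C *: (x : X).

Let scaleA a b x : scale a (scale b x) = scale (a * b) x.
Proof. by rewrite /scale scalerA -rmorphM. Qed.

Let scale1 : left_id 1 scale.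
Proof. by move=> x; rewrite /scale rmorph1 scale1r. Qed.

Let scaleDr : right_distributive scale +%R.
Proof. by move=> a x y; rewrite /scale scalerDr. Qed.

Let scaleDl x : {morph scale^~ x : a b / a + b}.
Proof. by move=> a b; rewrite /scale rmorphD scalerDl. Qed.

HB.instance Definition _ := GRing.Zmodule_isLmodule.Build R realification
  scaleA scale1 scaleDr scaleDl.

Let realification_vect :
  Vector.axiom (dim X + dim X) realification.
Proof.
exists (fun x : X => row_mx (map_mx (@complex.Re R) (v2r x))
                            (map_mx (@complex.Im R) (v2r x))).
  move=> a x y; have -> : a *: x + y = (a%:C)%C *: (x : X) + (y : X) by [].
  rewrite linearP /=.
  rewrite scale_row_mx add_row_mx; congr row_mx.
    apply/matrixP=> i j; rewrite !mxE raddfD/=.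
    by case: (v2r x i j) => u v /=; rewrite mul0r subr0.
  apply/matrixP=> i j; rewrite !mxE raddfD/=.
  by case: (v2r x i j) => u v /=; rewrite mul0r addr0.
exists (fun u => r2v (\row_j (lsubmx u 0 j +i* rsubmx u 0 j)%C)).
  move=> x; rewrite row_mxKl row_mxKr -[RHS]v2rK; congr r2v.
  by apply/rowP => j; rewrite !mxE; case: (v2r x 0 j).
move=> u; rewrite r2vK -[RHS]hsubmxK.
by congr row_mx; apply/rowP => j; rewrite !mxE.
Qed.

HB.instance Definition _ := Lmodule_hasFinDim.Build R realification
  realification_vect.

Definition realify_vspace (V : {vspace X}) : {vspace realification} :=
  <<[seq (x : realification) | x <- vbasis V] ++
    [seq ('i%C *: x : realification) | x <- vbasis V]>>%VS.

Lemma mem_realify_vspace (V : {vspace X}) (x : X) :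
  ((x : realification) \in realify_vspace V) = (x \in V).
Proof.
apply/idP/idP => [|xV].
  rewrite /realify_vspace span_cat => /memv_addP[u uV [v vV] ->].
  have sub (s : seq X) (t : realification) :
      {subset s <= V} -> t \in <<(s : seq realification)>>%VS -> (t : X) \in V.
    move=> sV; rewrite -[s]in_tupleE => /coord_span ->.
    elim/big_ind: _ => [|y z yV zV|i _]; first exact: (@mem0v _ _ V).
      exact: (@memvD _ _ V _ _ yV zV).
    exact: (@memvZ _ _ V _ _ (sV _ (mem_nth _ (ltn_ord i)))).
  apply: (@memvD _ _ V).
    by apply: (sub _ u _ uV) => y /mapP[z zV ->]; exact: vbasis_mem.
  apply: (sub _ v _ vV) => y /mapP[z zV ->].
  by apply: memvZ; exact: vbasis_mem.
have xE : x = \sum_(i < \dim V) coord (vbasis V) i x *: (vbasis V)`_i.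
  exact: coord_vbasis.
have -> : (x : realification) = \sum_(i < \dim V)
   (complex.Re (coord (vbasis V) i x) *: ((vbasis V)`_i : realification) +
    complex.Im (coord (vbasis V) i x) *:
      (('i%C *: (vbasis V)`_i : X) : realification)).
  rewrite {1}xE; apply: eq_bigr => i _.
  rewrite [LHS](_ : _ =
      (complex.Re (coord (vbasis V) i x))%:C%C *: (vbasis V)`_i +
      (complex.Im (coord (vbasis V) i x))%:C%C *: ('i%C *: (vbasis V)`_i)) //.
  rewrite scalerA -scalerDl; congr (_ *: _).
  case: (coord _ _ _) => a b /=; apply/eqP; rewrite eq_complex /=.
  by rewrite !(mul0r, mulr0, mulr1, subr0, addr0, add0r) !eqxx.
apply: memv_suml => i _; have iV : (vbasis V)`_i \in vbasis V.
  by rewrite mem_nth // size_tuple.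
apply: memvD; apply: memvZ; apply: memv_span; rewrite mem_cat; apply/orP.
  by left; exact: (map_f (fun x : X => x : realification) iV).
by right; exact: (map_f (fun x : X => ('i%C *: x) : realification) iV).
Qed.

Variable d : {dot X for @Num.conj R[i]}.

Definition Re_dot (x y : realification) : R := complex.Re (d x y).

Let ReMr (a : R) (z : R[i]) : complex.Re ((a%:C)%C * z) = a * complex.Re z.
Proof. by case: z => u v /=; rewrite mul0r subr0. Qed.

Let Re_dot_additivel y : zmod_morphism (Re_dot^~ y).
Proof. by move=> u v; rewrite /Re_dot linearBl raddfB. Qed.

Let Re_dot_additiver x : zmod_morphism (Re_dot x).
Proof. by move=> u v; rewrite /Re_dot linearBr raddfB. Qed.

Let Re_dot_scalablel y : scalable_for *%R (Re_dot^~ y).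
Proof.
move=> a u; rewrite /Re_dot.
have -> : a *: u = (a%:C)%C *: (u : X) :> X by [].
by rewrite linearZl ReMr.
Qed.

Let conjRe (a : R) : Num.conj ((a%:C)%C : R[i]) = (a%:C)%C.
Proof. by apply: conj_Creal; rewrite complex_real. Qed.

Let Re_dot_scalabler x : scalable_for (idfun \; *%R) (Re_dot x).
Proof.
move=> a u; rewrite /Re_dot.
have -> : a *: u = (a%:C)%C *: (u : X) :> X by [].
by rewrite linearZr /= conjRe ReMr.
Qed.

HB.instance Definition _ := @isBilinear.Build R realification realification R
  *%R (idfun \; *%R) Re_dot
  Re_dot_additivel Re_dot_additiver Re_dot_scalablel Re_dot_scalabler.

Let Re_conj (z : R[i]) : complex.Re (Num.conj z) = complex.Re z.
Proof. by case: z. Qed.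

Let Re_dot_hermitian x y : Re_dot x y = (-1) ^+ false * idfun (Re_dot y x).
Proof.
rewrite expr0 mul1r /= /Re_dot (hermC d x y) expr0 mul1r.
exact: Re_conj.
Qed.

HB.instance Definition _ := @isHermitianSesquilinear.Build R realification
  false idfun Re_dot Re_dot_hermitian.

Let Re_dot_gt0 x : x != 0 -> 0 < Re_dot x x.
Proof.
move=> /(@neq0_dnorm_gt0 _ _ _ d); rewrite /Re_dot ltcE /=.
by case/andP.
Qed.

HB.instance Definition _ := @isDotProduct.Build R realification Re_dot
  Re_dot_gt0.

End Realification.

Section LebesgueOnSubspaces.
Context {R : realType} {E : vectType R}.
Variable d : {dot E for idfun}.
Implicit Types (U : {vspace E}) (A : set E).

Definition orthonormal_basis U : (\dim U).-tuple E :=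
  xget (vbasis U)
    [set e : (\dim U).-tuple E | basis_of U e && orthonormal d e].

Definition coordinate_set U A : set ((\dim U).-tuple (measurableTypeR R)) :=
  [set t | A (\sum_(i < \dim U)
                 (tnth t i : R) *: tnth (orthonormal_basis U) i)].

Definition lebesgue_measurable_in U A : Prop :=
  lebesgue_measurable (@coordinate_set U A).

Definition lebesgue_in U A : \bar R := lebesgue (@coordinate_set U A).

(* A set lying in no subspace of dimension < k lies in at most one of dimension
   k, so the subspace picked in the second case is determined by A. A set lying
   in no subspace of dimension <= k gets a junk value. *)
Definition lebesgue_dim (k : nat) A : \bar R :=
  if `[< exists U, (\dim U < k)%N /\ A `<=` [set` U] >] then 0%E
  else lebesgue_in (xget 0%VS [set U | \dim U = k /\ A `<=` [set` U]]) A.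

End LebesgueOnSubspaces.

(* MathComp's dot products are linear in the left entry and theta-linear in the
   right one. Swapping the two entries changes none of the notions below, nor
   Re_dot: they only use orthogonality and values in the image of iota.
   The function iota is the embedding of R into the field of scalars K. *)
Section Angles.
Context {R : realType} {K : numFieldType} {theta : {rmorphism K -> K}}.
Context {X : vectType K}.
Variables (iota : R -> K) (d : {dot X for theta}).
Implicit Types V W : {vspace X}.

Definition orthogonal_projection W : 'End(X) := daddv_pi W (orthov d W).

Definition is_principal_angles V W
    (t : (minn (\dim V) (\dim W)).-tuple R) : Prop :=
  exists (e : (\dim V).-tuple X) (f : (\dim W).-tuple X),
  [/\ basis_of V e && orthonormal d e,
      basis_of W f && orthonormal d f,
      sorted <=%O t,
      (forall i, 0 <= tnth t i <= pi / 2) &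
      forall (i : 'I_(\dim V)) (j : 'I_(\dim W)),
        d (tnth e i) (tnth f j) =
        if i == j :> nat then iota (cos t`_i) else 0].

Definition principal_angles V W : (minn (\dim V) (\dim W)).-tuple R :=
  xget [tuple of nseq _ 0] (@is_principal_angles V W).

Definition Grassmann_angle V W : R :=
  if V == 0%VS then 0
  else if W == 0%VS then pi / 2
  else if (\dim V <= \dim W)%N
    then acos (\prod_(t <- principal_angles V W) cos t)
  else pi / 2.

End Angles.

(* Main.v *)
Require Import Defs.
From HB Require Import structures.
From mathcomp Require Import all_boot all_order all_algebra.
From mathcomp Require Import sesquilinear.
From mathcomp Require Import complex.
From mathcomp Require Import all_classical all_reals all_analysis.
From mathcomp Require Import measurable_realfun ring.

Set Implicit Arguments.
Unset Strict Implicit.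
Unset Printing Implicit Defensive.

Import Order.TTheory GRing.Theory Num.Theory.
Local Open Scope classical_set_scope.
Local Open Scope ring_scope.

(** Principal bases diagonalize the projection P of V to W: if e and f are
    orthonormal bases of V and W with <e_i, f_j> = delta_ij cos theta_i, then
    P e_i = cos theta_i f_i, or P e_i = 0 when W has run out of vectors f_i.
    Hence P stretches the i-th axis of V by c_i = cos theta_i (by 0 in the
    second case), keeps the axes orthogonal, and multiplies p-dimensional
    volume by the product of the c_i, which is the cosine of the Grassmann
    angle. In the complex case the vectors e_i and i e_i form an orthonormal
    basis of the underlying real space, P stretches both by c_i, and the factor
    is the square of that product.

    Three things have to be supplied.

    (1) A linear automorphism M of R^k satisfies |M^-1 A| = |A| / |det M| for
    every set A (lebesgue_preimage_act). For Borel sets this is an induction on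
    k: a block LU decomposition writes M as a product of maps that act either
    on the first coordinate or on the remaining ones only, and for those maps
    Fubini reduces the claim to a smaller dimension. Outer measure inherits the
    formula because preimage under M permutes the countable Borel covers. In
    particular an orthogonal change of basis preserves measure, so the measure
    on a subspace may be computed in any orthonormal basis
    (lebesgue_in_coordinates).

    (2) A linear map f for which the f e_i are orthogonal of length c_i
    multiplies measure by the product of the c_i (lebesgue_dim_image). If some
    c_i vanishes then f S lies in a subspace of dimension smaller than p and
    both sides are 0. Otherwise the f e_i / c_i are an orthonormal basis of
    f V, in which f is a diagonal matrix.

    (3) Principal bases exist (principal_angles_exist). The compression of P to
    V is self-adjoint, so it has an orthonormal basis of eigenvectors e_i; then
    <P e_i, P e_j> = <P e_i, e_j> vanishes for distinct i, j. Sorting the e_i by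
    decreasing |P e_i|, normalizing the nonzero P e_i and completing them to an
    orthonormal basis of W gives the second basis. This part treats real and
    complex scalars at once; only the existence of an eigenvector with a real
    eigenvalue is proved separately for each field. *)

(** * Maps that scale a measure *)

Section Scaling.
Local Open Scope ereal_scope.

(** Scaling is stated for preimages, so that no image has to be shown
    measurable and composition is immediate; the constant is therefore the
    inverse of the usual Jacobian. *)
Definition scales (R : realType) d (T : measurableType d)
    (mu : set T -> \bar R) (f : T -> T) (c : R) : Prop :=
  [/\ measurable_fun setT f, (0 < c)%R &
      forall A, measurable A -> mu (f @^-1` A) = c%:E * mu A].

Lemma scales_comp (R : realType) d (T : measurableType d)
    (mu : set T -> \bar R) (f g : T -> T) (a b : R) :
  scales mu f a -> scales mu g b -> scales mu (f \o g) (a * b)%R.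
Proof.
move=> [mf a0 fE] [mg b0 gE]; split; first exact: measurableT_comp.
  exact: mulr_gt0.
move=> A mA; rewrite comp_preimage gE; last first.
  by rewrite -[X in measurable X]setTI; exact: mf.
by rewrite fE// muleA -EFinM mulrC.
Qed.

Lemma scales_id (R : realType) d (T : measurableType d) (mu : set T -> \bar R) :
  scales mu id 1%R.
Proof. by split=> // A mA; rewrite mul1e preimage_id. Qed.

End Scaling.

(** * Affine maps of the line *)

Section OneDimension.
Context {R : realType}.
Local Open Scope ereal_scope.
Local Notation leb := (@lebesgue_measure R).
Implicit Types a : R.

Let shift a : measurableTypeR R -> measurableTypeR R := fun x => (x + a)%R.
Let homot a : measurableTypeR R -> measurableTypeR R := fun x => (a * x)%R.

Let measurable_shift a : measurable_fun setT (shift a).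
Proof. exact: measurable_funD. Qed.

Let measurable_homot a : measurable_fun setT (homot a).
Proof. exact: measurable_funM. Qed.

Lemma scales_shift a : scales leb (fun x => x + a)%R 1%R.
Proof.
split; [exact: measurable_shift|exact: ltr01|move=> A mA; rewrite mul1e].
pose nu := measure_function_pushforward__canonical__measure_function_Measure
  leb (measurable_shift a).
rewrite [RHS](@lebesgue_measure_unique R nu)// => _ [[x y]] _ <- /=.
rewrite /pushforward (_ : _ @^-1` _ = `]x - a, y - a]%classic)%R.
  rewrite !lebesgue_measure_itv/= !lte_fin ltrD2r.
  by rewrite -!EFinB opprD addrACA subrr addr0.
by apply/seteqP; split=> z /=; rewrite !in_itv/= ltrBlDr lerBrDr.
Qed.

Let scales_pos a : (0 < a)%R -> scales leb (fun x => a * x)%R a^-1.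
Proof.
move=> a0; split; [exact: measurable_homot|by rewrite invr_gt0|].
move=> A mA.
pose nu := mscale (NngNum (ltW a0))
  (measure_function_pushforward__canonical__measure_function_Measure
    leb (measurable_homot a)).
suff -> : leb A = nu A.
  rewrite /nu /mscale /= muleA -EFinM mulVf ?mul1e//.
  exact: lt0r_neq0.
apply: lebesgue_measure_unique mA => _ [[x y]] _ <- /=.
rewrite /mscale/= /pushforward (_ : _ @^-1` _ = `]x / a, y / a]%classic)%R.
  rewrite !lebesgue_measure_itv/= !lte_fin ltr_pM2r ?invr_gt0//.
  case: ifP => _; last by rewrite mule0.
  by rewrite -!EFinB -EFinM -mulrBl mulrC divfK ?gt_eqF.
by apply/seteqP; split=> z /=;
  rewrite !in_itv/= ltr_pdivrMr// ler_pdivlMr// ![(z * a)%R]mulrC.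
Qed.

Lemma scales_homothety a : a != 0%R ->
  scales leb (fun x => a * x)%R `|a|^-1%R.
Proof.
move=> a0; have [ap|an|a_eq0] := ltgtP a 0%R; last by rewrite a_eq0 eqxx in a0.
  rewrite ltr0_norm//.
  have := @scales_pos (- a)%R; rewrite oppr_gt0 => /(_ ap) sc.
  have opp1 : scales leb (-%R) 1%R.
    split; [exact: oppr_measurable|exact: ltr01|move=> A mA].
    by rewrite mul1e -[RHS]lebesgue_measureN.
  have := scales_comp opp1 sc; rewrite mul1r.
  by congr scales; apply/funext => x /=; rewrite mulNr opprK.
by rewrite gtr0_norm//; exact: scales_pos.
Qed.

End OneDimension.

(** * Linear maps of the coordinate space *)

Section LinearMaps.
Context {R : realType}.
Local Notation Rt k := (k.-tuple (measurableTypeR R)).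

Definition colt k (t : Rt k) : 'cV[R]_k := \col_i tnth t i.
Definition tcol k (x : 'cV[R]_k) : Rt k := [tuple x i 0 | i < k].
Definition act k (M : 'M[R]_k) (t : Rt k) : Rt k := tcol (M *m colt t).
Definition translate k (v : 'cV[R]_k) (t : Rt k) : Rt k := tcol (colt t + v).

Lemma coltK k : cancel (@colt k) (@tcol k).
Proof. by move=> t; apply: eq_from_tnth => i; rewrite tnth_mktuple mxE. Qed.

Lemma tcolK k : cancel (@tcol k) (@colt k).
Proof. by move=> x; apply/colP => i; rewrite mxE tnth_mktuple. Qed.

Lemma colt_cons k (x : R) (t : Rt k) :
  colt ([tuple of x :: t] : Rt k.+1) = col_mx x%:M (colt t) :> 'cV_(1 + k).
Proof.
apply/colP => i; rewrite [LHS]mxE.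
case: (@split_ordP 1 k i) => j ->.
  by rewrite (col_mxEu (x%:M : 'M[R]_1)) ord1 mxE eqxx lshift0 tnth0.
by rewrite (col_mxEd (x%:M : 'M[R]_1)) mxE rshift1 tnthS.
Qed.

Lemma tcol_col_mx k (x : R) (y : 'cV[R]_k) :
  tcol (col_mx x%:M y : 'cV_(1 + k)) = [tuple of x :: tcol y] :> Rt k.+1.
Proof. by apply: (can_inj (@coltK k.+1)); rewrite colt_cons !tcolK. Qed.

Lemma actM k (M N : 'M[R]_k) : act (M *m N) = act M \o act N.
Proof. by apply/funext => t; rewrite /act /= tcolK mulmxA. Qed.

Lemma act1 k : act (1%:M : 'M[R]_k) = id.
Proof. by apply/funext => t; rewrite /act mul1mx coltK. Qed.

Lemma translateD k (v w : 'cV[R]_k) :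
  translate (v + w) = translate v \o translate w.
Proof. by apply/funext => t; rewrite /translate /= tcolK -addrA (addrC v). Qed.

Lemma translate0 k : translate (0 : 'cV[R]_k) = id.
Proof. by apply/funext => t; rewrite /translate addr0 coltK. Qed.

Lemma translate_cons k (a : R) (w : 'cV[R]_k) (x : R) (t : Rt k) :
  translate (col_mx a%:M w : 'cV_(1 + k)) ([tuple of x :: t] : Rt k.+1) =
  [tuple of x + a :: translate w t].
Proof.
by rewrite -tcol_col_mx /translate colt_cons add_col_mx -raddfD.
Qed.

Lemma measurable_affine k (M : 'M[R]_k) (v : 'cV[R]_k) :
  measurable_fun [set: Rt k] (fun t => tcol (M *m colt t + v)).
Proof.
apply/measurable_fun_tnthP => i.
rewrite (_ : _ \o _ =
    (fun t : Rt k => \sum_j M i j * tnth t j + v i 0)); last first.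
  by apply/funext => t /=; rewrite tnth_mktuple !mxE;
    congr (_ + _); apply: eq_bigr => j _; rewrite mxE.
apply: measurable_funD => //; apply: measurable_sum => j.
by apply: measurable_funM => //; exact: measurable_tnth.
Qed.

Lemma measurable_act k (M : 'M[R]_k) : measurable_fun [set: Rt k] (act M).
Proof.
rewrite (_ : act M = fun t => tcol (M *m colt t + 0)).
  exact: measurable_affine.
by apply/funext => t; rewrite addr0.
Qed.

Lemma measurable_translate k (v : 'cV[R]_k) :
  measurable_fun [set: Rt k] (translate v).
Proof.
rewrite (_ : translate v = fun t => tcol (1%:M *m colt t + v)).
  exact: measurable_affine.
by apply/funext => t; rewrite mul1mx.
Qed.

Lemma act_block_mx k (a : R) (r : 'rV[R]_k) (c : 'cV[R]_k) (N : 'M[R]_k)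
    (x : R) (t : Rt k) :
  act (block_mx a%:M r c N : 'M[R]_(1 + k)) ([tuple of x :: t] : Rt k.+1) =
  [tuple of (a * x + (r *m colt t) 0 0) :: tcol (x *: c + N *m colt t)].
Proof.
rewrite -tcol_col_mx /act colt_cons mul_block_col; congr tcol.
congr col_mx; last by rewrite mul_mx_scalar.
by rewrite -scalar_mxM [X in _ + X]mx11_scalar -raddfD.
Qed.

(** Tonelli: every slice at a fixed first coordinate is scaled by the same
    constant, which therefore comes out of the integral over that coordinate. *)
Lemma scales_fiber_tail k (f : Rt k.+1 -> Rt k.+1) (phi : R -> Rt k -> Rt k) c :
  measurable_fun setT f ->
  (forall (x : R) (t : Rt k), f [tuple of x :: t] = [tuple of x :: phi x t]) ->
  (forall x, scales (borel_lebesgue k) (phi x) c) ->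
  scales (borel_lebesgue k.+1) f c.
Proof.
move=> mf fE phic; have [_ c0 _] := phic 0%R; split=> // A mA.
have mB : measurable (@cons_pair R k @^-1` A).
  by rewrite -[X in measurable X]setTI; exact: measurable_cons_pair.
rewrite /= /lebesgue_step /pushforward /product_measure1 -ge0_integralZl//=.
- apply: eq_integral => x _.
  have [_ _ /(_ _ (measurable_xsection x mB)) <-] := phic x.
  congr (borel_lebesgue k _); apply/seteqP; split=> t;
    by rewrite /= /xsection /= !inE /= /cons_pair /= fE.
- exact: measurable_fun_xsection.
- by rewrite lee_fin ltW.
Qed.

(** The same argument with the order of integration exchanged, for maps that
    move only the first coordinate. *)
Lemma scales_fiber_head k (f : Rt k.+1 -> Rt k.+1) (psi : Rt k -> R -> R) c :
  measurable_fun setT f ->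
  (forall (x : R) (t : Rt k), f [tuple of x :: t] = [tuple of psi t x :: t]) ->
  (forall t, scales (@lebesgue_measure R) (psi t) c) ->
  scales (borel_lebesgue k.+1) f c.
Proof.
move=> mf fE psic; have [_ c0 _] := psic (tcol 0%R); split=> // A mA.
(* The measure is defined by slicing along the first coordinate; slicing along
   the others gives the same measure. *)
have fubini B : measurable B -> borel_lebesgue k.+1 B =
    (lebesgue_measure \x^ borel_lebesgue k)%E (@cons_pair R k @^-1` B).
  move=> mB; rewrite /= /lebesgue_step /pushforward.
  apply: product_measure_unique => /=.
    by move=> C D mC mD; rewrite product_measure2E.
  by rewrite -[X in measurable X]setTI; exact: measurable_cons_pair.
have mfA : measurable (f @^-1` A) by rewrite -[X in measurable X]setTI; exact: mf.
have mB : measurable (@cons_pair R k @^-1` A).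
  by rewrite -[X in measurable X]setTI; exact: measurable_cons_pair.
rewrite !fubini// /product_measure2 -ge0_integralZl//=.
- apply: eq_integral => t _.
  have [_ _ /(_ _ (measurable_ysection t mB)) <-] := psic t.
  congr (lebesgue_measure _); apply/seteqP; split=> x;
    by rewrite /= /ysection /= !inE /= /cons_pair /= fE.
- exact: measurable_fun_ysection.
- by rewrite lee_fin ltW.
Qed.

Lemma scales_translate k (v : 'cV[R]_k) :
  scales (borel_lebesgue k) (translate v) 1%R.
Proof.
elim: k v => [|k IH] v.
  rewrite (_ : translate v = id); first exact: scales_id.
  by apply/funext => t; rewrite tuple0 [RHS]tuple0.
pose a := usubmx (v : 'cV_(1 + k)) 0 0; pose w := dsubmx (v : 'cV_(1 + k)).
have -> : translate v = translate (col_mx a%:M 0 : 'cV_(1 + k)) \o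
                        translate (col_mx 0%:M w : 'cV_(1 + k)).
  rewrite -translateD; congr translate.
  rewrite add_col_mx -raddfD/= addr0 add0r -mx11_scalar.
  by rewrite -[LHS](@vsubmxK _ 1 k).
rewrite -[1%R]mulr1; apply: scales_comp.
  apply: (@scales_fiber_head _ _ (fun _ x => x + a)%R) => [|x t|t].
  - exact: measurable_translate.
  - by rewrite translate_cons translate0.
  - exact: scales_shift.
apply: (@scales_fiber_tail _ _ (fun _ => translate w)) => // [|x t].
  exact: measurable_translate.
by rewrite translate_cons addr0.
Qed.

Definition det_scales k (M : 'M[R]_k) : Prop :=
  scales (borel_lebesgue k) (act M) `|\det M|^-1.

Lemma det_scales_mul k (M N : 'M[R]_k) :
  det_scales M -> det_scales N -> det_scales (M *m N).
Proof.
rewrite /det_scales det_mulmx normrM invfM actM; exact: scales_comp.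
Qed.

Section Block.
Variable k : nat.

Lemma det_scales_lshear (c : 'cV[R]_k) :
  det_scales (block_mx 1%:M 0 c 1%:M : 'M[R]_(1 + k)).
Proof.
rewrite /det_scales (det_lblock (1%:M : 'M[R]_1)) !det1 mulr1 normr1 invr1.
apply: (@scales_fiber_tail _ _ (fun x => translate (x *: c))) => [|x t|x].
- exact: measurable_act.
- by rewrite act_block_mx mul1r mul0mx mxE addr0 mul1mx /translate addrC.
- exact: scales_translate.
Qed.

Lemma det_scales_ushear (r : 'rV[R]_k) :
  det_scales (block_mx 1%:M r 0 1%:M : 'M[R]_(1 + k)).
Proof.
rewrite /det_scales (det_ublock (1%:M : 'M[R]_1)) !det1 mulr1 normr1 invr1.
apply: (@scales_fiber_head _ _ (fun t x => x + (r *m colt t) 0 0)%R)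
  => [|x t|t].
- exact: measurable_act.
- by rewrite act_block_mx mul1r scaler0 add0r mul1mx coltK.
- exact: scales_shift.
Qed.

Lemma det_scales_diag (a : R) (N : 'M[R]_k) : a != 0%R -> det_scales N ->
  det_scales (block_mx a%:M 0 0 N : 'M[R]_(1 + k)).
Proof.
move=> a0 scN.
have -> : block_mx a%:M 0 0 N = block_mx a%:M 0 0 1%:M *m
    block_mx 1%:M 0 0 N :> 'M[R]_(1 + k).
  by rewrite mulmx_block !mulmx1 !mul1mx !mul0mx !mulmx0 !addr0 !add0r.
apply: det_scales_mul.
  rewrite /det_scales (det_lblock (a%:M : 'M[R]_1)) det_scalar1 det1 mulr1.
  apply: (@scales_fiber_head _ _ (fun _ x => a * x)%R) => [|x t|t].
  - exact: measurable_act.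
  - by rewrite act_block_mx mul0mx mxE addr0 scaler0 add0r mul1mx coltK.
  - exact: scales_homothety.
rewrite /det_scales (det_lblock (1%:M : 'M[R]_1)) det1 mul1r.
apply: (@scales_fiber_tail _ _ (fun _ => act N)) => // [|x t].
  exact: measurable_act.
by rewrite act_block_mx mul0mx mxE mul1r addr0 scaler0 add0r.
Qed.

(** Block LU decomposition: with a nonzero corner a, the matrix is a lower shear
    times diag(a, S) times an upper shear, where S is the Schur complement of a.
    Shears translate each fiber, hence preserve measure. *)
Lemma det_scales_block (a : R) (r : 'rV[R]_k) (c : 'cV[R]_k) (N : 'M[R]_k) :
    (forall S : 'M[R]_k, S \in unitmx -> det_scales S) ->
  a != 0%R -> block_mx a%:M r c N \in unitmx ->
  det_scales (block_mx a%:M r c N : 'M[R]_(1 + k)).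
Proof.
move=> IH a0; pose S := (N - a^-1 *: (c *m r))%R.
have -> : block_mx a%:M r c N = block_mx 1%:M 0 (a^-1 *: c) 1%:M *m
    (block_mx a%:M 0 0 S *m block_mx 1%:M (a^-1 *: r) 0 1%:M)
    :> 'M[R]_(1 + k).
  rewrite !mulmx_block !mulmx1 !mul1mx !mul0mx !mulmx0 !addr0 !add0r.
  congr block_mx.
  - by rewrite mul_scalar_mx scalerA mulfV// scale1r.
  - by rewrite mul_mx_scalar scalerA mulfV// scale1r.
  - rewrite mul_scalar_mx scalerA mulfV// scale1r -scalemxAl /S.
    by rewrite addrC subrK.
rewrite !unitmx_mul => /and3P[_ uS _].
apply: det_scales_mul; first exact: det_scales_lshear.
apply: det_scales_mul; last exact: det_scales_ushear.
apply: det_scales_diag => //; apply: IH.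
move: uS; rewrite !unitmxE (det_lblock (a%:M : 'M[R]_1)) unitrM.
by case/andP.
Qed.

End Block.

(** When the corner of M vanishes, invertibility gives a nonzero entry below
    it; adding that row to the first one, which is an upper shear, makes the
    corner nonzero. *)
Lemma unitmx_det_scales k (M : 'M[R]_k) : M \in unitmx -> det_scales M.
Proof.
elim: k M => [|k IH]; last rewrite -[k.+1]/(1 + k)%N; move=> M uM.
  rewrite /det_scales det_mx00 normr1 invr1 (_ : act M = id).
    exact: scales_id.
  by apply/funext => t; rewrite tuple0 [RHS]tuple0.
have block_ne0 (B : 'M[R]_(1 + k)) : B \in unitmx -> ulsubmx B 0 0 != 0%R ->
    det_scales B.
  move=> uB B0; move: (uB); rewrite -(submxK B) [ulsubmx B]mx11_scalar => uB'.
  exact: det_scales_block.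
have [M0|] := eqVneq (ulsubmx M 0 0) 0%R; last exact: block_ne0.
have [i ci] : exists i, dlsubmx M i 0 != 0%R.
  apply/existsP; rewrite -negb_forall; apply: contraTN uM => /forallP c0.
  have -> : M = block_mx 0 (ursubmx M) 0 (drsubmx M) :> 'M[R]_(1 + k).
    rewrite -[LHS](@submxK _ 1 k 1 k M); congr block_mx.
      by rewrite [LHS]mx11_scalar M0 raddf0.
    by apply/colP => j; rewrite [RHS]mxE; exact/eqP/c0.
  by rewrite unitmxE (det_ublock (0 : 'M[R]_1)) det_mx11 mxE mul0r unitr0.
pose U r := block_mx 1%:M r 0 1%:M : 'M[R]_(1 + k).
pose r : 'rV[R]_k := delta_mx 0 i.
have uU : U r \in unitmx.
  by rewrite unitmxE (det_ublock (1%:M : 'M[R]_1)) !det1 mulr1 unitr1.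
have -> : M = U (- r) *m (U r *m M) :> 'M[R]_(1 + k).
  rewrite mulmxA /U mulmx_block !mulmx1 !mul1mx !mul0mx !mulmx0 !addr0 !add0r.
  by rewrite subrr -scalar_mx_block mul1mx.
apply: det_scales_mul; first exact: det_scales_ushear.
apply: block_ne0; first by rewrite unitmx_mul uU.
rewrite /U -(@submxK _ 1 k 1 k M) mulmx_block block_mxKul mul1mx mxE M0 add0r.
by rewrite -rowE mxE.
Qed.

(** Outer measure is an infimum over countable Borel covers, and preimage under
    M sends covers of A to covers of the preimage of A. This bounds the measure
    of the preimage from above; the same bound for the inverse of M gives the
    equality. *)
Lemma lebesgue_preimage_act k (M : 'M[R]_k) (A : set (Rt k)) : M \in unitmx ->
  lebesgue (act M @^-1` A) = (`|\det M|^-1%:E * lebesgue A)%E.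
Proof.
have lebesgue_le (N : 'M[R]_k) B : N \in unitmx ->
    (lebesgue (act N @^-1` B) <= `|\det N|^-1%:E * lebesgue B)%E.
  move=> uN; have [mN N0 scN] := unitmx_det_scales uN.
  rewrite -lee_pdivrMl// /lebesgue /completed_measure_extension.
  apply: le_ereal_inf_tmp => _ [F [mF BF] <-].
  have mNF n : measurable (act N @^-1` F n).
    by rewrite -[X in measurable X]setTI; exact: mN.
  rewrite lee_pdivrMl// -nneseriesZl//.
  apply: ereal_inf_lbound; exists (fun n => act N @^-1` F n) => /=.
    by split=> //; rewrite -preimage_bigcup; exact: preimage_subset.
  by apply: eq_eseriesr => n _; exact: scN.
move=> uM; apply/eqP; rewrite eq_le lebesgue_le//=.
have uV : invmx M \in unitmx by rewrite unitmx_inv.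
have := lebesgue_le _ (act M @^-1` A) uV.
rewrite -comp_preimage -actM mulmxV// act1 preimage_id.
rewrite det_inv normfV invrK => le.
have M0 : 0 < `|\det M| by rewrite normr_gt0 -unitfE -unitmxE.
by rewrite -lee_pdivlMl ?invr_gt0// invrK.
Qed.

End LinearMaps.

(** * Orthonormal bases *)

Section Orthonormal.
Context {K : numFieldType} {theta : {rmorphism K -> K}} {X : vectType K}.
Variable d : {dot X for theta}.
Implicit Types (U V : {vspace X}) (s : seq X) (u v : X).

Lemma dot_sym u v : d u v = theta (d v u).
Proof. by rewrite hermC expr0 mul1r. Qed.

Lemma dot_sym0 u v : d u v = 0 -> d v u = 0.
Proof. by move=> uv0; rewrite dot_sym uv0 rmorph0. Qed.

Lemma dot_ge0 u : 0 <= d u u.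
Proof.
have [->|/(neq0_dnorm_gt0 (s := d))/ltW//] := eqVneq u 0.
by rewrite linear0l.
Qed.

Lemma dot_eq0 u : (d u u == 0) = (u == 0).
Proof.
apply/eqP/eqP => [|->]; last by rewrite linear0l.
by apply: contra_eq => /(neq0_dnorm_gt0 (s := d))/gt_eqF/negbT.
Qed.

Lemma orthonormal_nthP s :
  reflect (forall i j, (i < size s)%N -> (j < size s)%N ->
             d s`_i s`_j = (i == j)%:R) (orthonormal d s).
Proof.
have pairE : pair_ortho_rec d s = pairwise (fun u v => d u v == 0) s.
  by elim: s => //= u s ->; rewrite /ortho_rec /= andbT.
rewrite /orthonormal pairE; apply: (iffP andP) => [[/allP s1 /(pairwiseP 0) so]|so].
  have ltE i j : (i < j)%N -> (j < size s)%N -> d s`_i s`_j = 0.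
    by move=> ij js; apply/eqP/so => //; exact: ltn_trans js.
  move=> i j ilt jlt; have [ij|ji|<-] := ltngtP i j.
  - exact: ltE.
  - exact/dot_sym0/ltE.
  - exact/eqP/s1/mem_nth.
split; first by apply/(all_nthP 0) => i ilt /=; rewrite so// eqxx.
apply/(pairwiseP 0) => i j ilt jlt ij.
by rewrite so// ltn_eqF.
Qed.

Lemma orthonormal_tnth n (e : n.-tuple X) :
  (forall i j, d (tnth e i) (tnth e j) = (i == j)%:R) -> orthonormal d e.
Proof.
move=> eo; apply/orthonormal_nthP => i j; rewrite size_tuple => ilt jlt.
by rewrite -(tnth_nth 0 e (Ordinal ilt)) -(tnth_nth 0 e (Ordinal jlt)) eo.
Qed.

Lemma orthonormal_memP s :
  reflect (uniq s /\ {in s &, forall u v, d u v = (u == v)%:R})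
          (orthonormal d s).
Proof.
apply: (iffP (orthonormal_nthP s)) => [so|[us so] i j ilt jlt].
  split.
    apply/(uniqP 0) => i j ilt jlt sij; apply/eqP.
    have := so i j ilt jlt; rewrite -sij so// eqxx.
    by case: eqP => // _ /eqP; rewrite oner_eq0.
  move=> u v /(nthP 0)[i ilt <-] /(nthP 0)[j jlt <-]; rewrite so//.
  have [->|ij] := eqVneq i j; first by rewrite eqxx.
  case: eqP => // sij; move: (so i j ilt jlt); rewrite -sij so// eqxx.
  by rewrite (negbTE ij).
by rewrite so ?mem_nth// nth_uniq.
Qed.

Lemma perm_orthonormal s s' : perm_eq s s' -> orthonormal d s = orthonormal d s'.
Proof.
move=> ss'; apply/orthonormal_memP/orthonormal_memP => -[us so]; split.
- by rewrite -(perm_uniq ss').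
- by move=> u v; rewrite -!(perm_mem ss'); exact: so.
- by rewrite (perm_uniq ss').
- by move=> u v; rewrite !(perm_mem ss'); exact: so.
Qed.

Lemma orthonormal_coord n (e : n.-tuple X) (a : 'I_n -> K) i :
  orthonormal d e -> d (\sum_j a j *: tnth e j) (tnth e i) = a i.
Proof.
move=> /orthonormal_nthP eo; rewrite linear_sumlz (bigD1 i)//= big1 => [|j ji].
  by rewrite addr0 linearZl_LR/= (tnth_nth 0) eo ?size_tuple// eqxx mulr1.
rewrite linearZl_LR/= !(tnth_nth 0) eo ?size_tuple//.
by move: ji; rewrite -val_eqE => /negbTE->; rewrite mulr0.
Qed.

Lemma orthonormal_free s : orthonormal d s -> free s.
Proof.
rewrite -[s]in_tupleE => so; apply/freeP => a a0 i.
rewrite -(orthonormal_coord a i so) -[RHS](linear0l d (tnth (in_tuple s) i)).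
by congr (d _ _); rewrite -[RHS]a0; apply: eq_bigr => j _; rewrite (tnth_nth 0).
Qed.

Definition orthonormal_basis_of V s := basis_of V s && orthonormal d s.

Lemma orthonormal_basisP V s : orthonormal d s -> {subset s <= V} ->
  (\dim V <= size s)%N -> orthonormal_basis_of V s.
Proof.
move=> so sV dV; rewrite /orthonormal_basis_of so andbT basisEfree.
by rewrite orthonormal_free//= dV andbT; exact/span_subvP.
Qed.

Lemma orthonormal_basis_size V s : orthonormal_basis_of V s -> size s = \dim V.
Proof. by move=> /andP[/andP[/eqP <- /eqP]]. Qed.

Lemma orthonormal_basis_mem V s u :
  orthonormal_basis_of V s -> u \in s -> u \in V.
Proof. by move=> /andP[sV _]; exact: basis_mem. Qed.

Lemma orthonormal_basis_coord V n (e : n.-tuple X) v :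
  orthonormal_basis_of V e -> v \in V ->
  v = \sum_i d v (tnth e i) *: tnth e i.
Proof.
move=> /andP[eV eo] /(coord_basis eV) vE.
rewrite {1}vE; apply: eq_bigr => i _; rewrite -tnth_nth; congr (_ *: _).
rewrite {2}vE -(orthonormal_coord (coord e ^~ v) i eo); congr (d _ _).
by apply: eq_bigr => j _; rewrite -tnth_nth.
Qed.

End Orthonormal.

(** * Measure on subspaces *)

Section LebesgueOrthonormal.
Context {R : realType} {E : vectType R}.
Variable d : {dot E for idfun}.
Implicit Types (V : {vspace E}) (A S : set E).

Definition coordinates n (e : n.-tuple E) A : set (n.-tuple (measurableTypeR R)) :=
  [set t | A (\sum_i (tnth t i : R) *: tnth e i)].

(** The matrix that changes coordinates between two orthonormal bases is
    orthogonal, so its determinant has absolute value 1. *)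
Lemma lebesgue_coordinates V n (e e' : n.-tuple E) A :
  orthonormal_basis_of d V e -> orthonormal_basis_of d V e' ->
  lebesgue (coordinates e A) = lebesgue (coordinates e' A).
Proof.
move=> eV e'V; pose M := \matrix_(i, j) d (tnth e j) (tnth e' i).
have MMT : M *m M^T = 1%:M.
  apply/matrixP => i j; rewrite !mxE.
  have e'i : tnth e' i \in V by apply: (orthonormal_basis_mem e'V); exact: mem_tnth.
  transitivity (d (tnth e' j) (tnth e' i)).
    have e'j : tnth e' j \in V.
      by apply: (orthonormal_basis_mem e'V); exact: mem_tnth.
    rewrite [in RHS](orthonormal_basis_coord eV e'j) linear_sumlz.
    apply: eq_bigr => k _; rewrite !mxE linearZl_LR/= mulrC; congr (_ * _).
    by rewrite dot_sym.
  have /andP[_ /orthonormal_nthP so] := e'V.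
  by rewrite !(tnth_nth 0) so ?size_tuple// eq_sym.
have detM : `|\det M| = 1.
  have /(congr1 determinant) := MMT; rewrite det_mulmx det_tr det1 => /eqP.
  by rewrite -expr2 sqrf_eq1 => /orP[] /eqP ->; rewrite ?normrN normr1.
have uM : M \in unitmx by rewrite unitmxE unitfE -normr_eq0 detM oner_eq0.
rewrite (_ : coordinates e A = act M @^-1` coordinates e' A).
  by rewrite lebesgue_preimage_act// detM invr1 mul1e.
apply/funext => t; rewrite /coordinates/=; congr A.
have memV (u : n.-tuple E) j : orthonormal_basis_of d V u -> tnth u j \in V.
  by move=> uV; apply: (orthonormal_basis_mem uV); exact: mem_tnth.
have sumV : \sum_i (tnth t i : R) *: tnth e i \in V.
  by apply: memv_suml => j _; rewrite memvZ// memV.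
rewrite (orthonormal_basis_coord e'V sumV).
apply: eq_bigr => i _; congr (_ *: _); rewrite linear_sumlz tnth_mktuple mxE.
by apply: eq_bigr => j _; rewrite linearZl_LR/= !mxE mulrC.
Qed.

Lemma lebesgue_in_coordinates V n (e : n.-tuple E) A :
  orthonormal_basis_of d V e -> lebesgue_in d V A = lebesgue (coordinates e A).
Proof.
move=> eV; have nV : n = \dim V.
  by have /andP[/size_basis ->] := eV.
subst n; apply: (lebesgue_coordinates _ _ eV); rewrite /orthonormal_basis.
exact: (@xgetPex _ (vbasis V) [set e : (\dim V).-tuple E | basis_of V e &&
  orthonormal d e] (ex_intro _ e eV)).
Qed.

(** A subspace U of the dimension of V that contains A must be V itself, since
    otherwise A would lie in the smaller intersection of U and V. *)
Lemma lebesgue_dim_in V A : A `<=` [set` V] ->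
  ~ (exists U : {vspace E}, (\dim U < \dim V)%N /\ A `<=` [set` U]) ->
  lebesgue_dim d (\dim V) A = lebesgue_in d V A.
Proof.
move=> AV nU; rewrite /lebesgue_dim; case: asboolP => // _.
congr (lebesgue_in d _ A).
have := @xgetPex _ 0%VS [set U : {vspace E} | \dim U = \dim V /\ A `<=` [set` U]]
  (ex_intro _ V (conj erefl AV)).
move: (xget _ _) => U /= [dUV AU].
have dV : (\dim V <= \dim (U :&: V))%N.
  rewrite leqNgt; apply/negP => lt; apply: nU; exists (U :&: V)%VS; split=> //.
  by move=> x Ax /=; rewrite memv_cap (AU _ Ax) (AV _ Ax).
have VE : (U :&: V)%VS = V by apply/eqP; rewrite eqEdim capvSr.
have UE : (U :&: V)%VS = U by apply/eqP; rewrite eqEdim capvSl dUV.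
by rewrite -UE VE.
Qed.

(** If every c_i is positive, f is injective on V, so f S lies in a subspace of
    dimension less than n exactly when S does; this matches the two cases in the
    definition of the measure. If some c_i is 0, the image is too thin and its
    measure is 0, also when S has infinite measure, by the convention that
    0 times infinity is 0. *)
Lemma lebesgue_dim_image V n (e : n.-tuple E) (f : 'End(E)) (c : 'I_n -> R) S :
  orthonormal_basis_of d V e -> (forall i, 0 <= c i) ->
  (forall i j, d (f (tnth e i)) (f (tnth e j)) =
     if i == j then c i ^+ 2 else 0) ->
  S `<=` [set` V] ->
  lebesgue_dim d n (f @` S) = (lebesgue_dim d n S * (\prod_i c i)%:E)%E.
Proof.
move=> eV c0 fe SV; have nV : n = \dim V.
  by have /andP[/size_basis ->] := eV.
have eiV i : tnth e i \in V.
  by apply: (orthonormal_basis_mem eV); exact: mem_tnth.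
have fSV : f @` S `<=` [set` (f @: V)%VS].
  by move=> _ [s Ss <-] /=; rewrite memv_img//; exact: SV.
have [/existsP[i /eqP ci0]|] := boolP [exists i, c i == 0].
  rewrite (bigD1 i)//= ci0 mul0r mule0 /lebesgue_dim; case: asboolP => // -[].
  exists (f @: V)%VS; split=> //; rewrite nV -(limg_ker_dim f V).
  rewrite -[ltnLHS]add0n ltn_add2r lt0n dimv_eq0; apply/negP => /eqP ker0.
  have : tnth e i \in (V :&: lker f)%VS.
    rewrite memv_cap eiV memv_ker -(dot_eq0 d) fe eqxx ci0.
    by rewrite expr0n eqxx.
  rewrite ker0 memv0 -(dot_eq0 d) (tnth_nth 0).
  have /andP[_ /orthonormal_nthP ->] := eV; rewrite ?size_tuple//.
  by rewrite eqxx oner_eq0.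
rewrite negb_exists => /forallP cn0.
have cgt0 i : 0 < c i by rewrite lt_def cn0 c0.
(* In the bases e and g of V and of f V, f is the diagonal matrix of the c i. *)
pose g := [tuple (c i)^-1 *: f (tnth e i) | i < n].
have dZ a b x y : d (a *: f x) (b *: y) = a * (b * d (f x) y).
  by rewrite linearZl_LR linearZr_LR.
have dfg v i : v \in V -> d (f v) (tnth g i) = c i * d v (tnth e i).
  move=> vV; rewrite {1}(orthonormal_basis_coord eV vV) linear_sum linear_sumlz.
  rewrite (bigD1 i)//= big1 => [|j ji].
    rewrite tnth_mktuple [f _]linearZ dZ fe eqxx addr0.
    by rewrite expr2 [X in _ * X]mulrA mulVf// mul1r mulrC.
  by rewrite tnth_mktuple [f _]linearZ dZ fe (negbTE ji) !mulr0.
have eo i j : d (tnth e i) (tnth e j) = (i == j)%:R.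
  by have /andP[_ /orthonormal_nthP so] := eV; rewrite !(tnth_nth 0) so ?size_tuple.
have go : orthonormal d g.
  apply: orthonormal_tnth => i j.
  rewrite {1}tnth_mktuple linearZl_LR/= dfg// eo.
  by case: eqVneq => [->|_]; rewrite ?mulr0// mulr1 mulVf.
have kerfV : (V :&: lker f = 0)%VS.
  apply/eqP; rewrite -subv0; apply/subvP => v; rewrite memv_cap memv_ker memv0.
  move=> /andP[vV /eqP fv0]; rewrite (orthonormal_basis_coord eV vV) big1// => i _.
  have /eqP := dfg v i vV; rewrite fv0 linear0l eq_sym mulf_eq0 (negbTE (cn0 i)).
  by move=> /eqP ->; rewrite scale0r.
have finj : {in V &, injective f}.
  move=> u v uV vV fuv; apply/eqP; rewrite -subr_eq0 -memv0 -kerfV memv_cap.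
  by rewrite memvB// memv_ker linearB/= fuv subrr.
have dimfV : \dim (f @: V)%VS = n by rewrite limg_dim_eq.
have gV : orthonormal_basis_of d (f @: V)%VS g.
  apply: orthonormal_basisP; rewrite ?dimfV ?size_tuple// => _ /mapP[i _ ->].
  by rewrite memvZ// memv_img.
have thinE : (exists U : {vspace E}, (\dim U < n)%N /\ f @` S `<=` [set` U]) <->
             (exists U : {vspace E}, (\dim U < n)%N /\ S `<=` [set` U]).
  split=> -[U [dU SU]].
    exists (V :&: f @^-1: U)%VS; split.
      apply: leq_ltn_trans dU; rewrite -(@limg_dim_eq _ _ _ f); last first.
        by apply/eqP; rewrite -subv0 -kerfV capvS// capvSl.
      apply: dimvS; apply/subvP => _ /memv_imgP[v + ->].
      by rewrite memv_cap -memv_preim => /andP[].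
    move=> s Ss /=; rewrite memv_cap SV//= -memv_preim.
    by apply: SU; exists s.
  exists (f @: U)%VS; split.
    by apply: leq_ltn_trans dU; rewrite -[leqRHS](limg_ker_dim f) leq_addl.
  by move=> _ [s Ss <-] /=; rewrite memv_img//; exact: SU.
have [thin|fat] :=
  pselect (exists U : {vspace E}, (\dim U < n)%N /\ S `<=` [set` U]).
  rewrite /lebesgue_dim; case: asboolP => [_|]; last by move/thinE: thin.
  by case: asboolP => // _; rewrite mul0e.
rewrite -{1}dimfV lebesgue_dim_in ?dimfV//; last by rewrite thinE.
have -> : lebesgue_dim d n S = lebesgue_in d V S.
  by rewrite {1}nV lebesgue_dim_in// -nV.
rewrite (lebesgue_in_coordinates _ eV) (lebesgue_in_coordinates _ gV).
pose D := diag_mx (\row_i (c i)^-1).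
have detD : \det D = (\prod_i c i)^-1.
  by rewrite det_diag -prodfV; apply: eq_bigr => i _; rewrite mxE.
have c_gt0 : 0 < \prod_i c i by exact: prodr_gt0.
rewrite (_ : coordinates g _ = act D @^-1` coordinates e S).
  rewrite lebesgue_preimage_act ?unitmxE ?unitfE detD ?invr_eq0 ?gt_eqF//.
  by rewrite gtr0_norm ?invr_gt0// invrK muleC.
apply/funext => t; rewrite /coordinates /=.
pose v := \sum_i (tnth (act D t) i : R) *: tnth e i.
have vV : v \in V by apply: memv_suml => i _; rewrite memvZ.
have -> : \sum_i (tnth t i : R) *: tnth g i = f v.
  rewrite linear_sum; apply: eq_bigr => i _.
  rewrite linearZ/= !tnth_mktuple mul_diag_mx !mxE scalerA mulrC//.
apply/propext; split=> [[s Ss /finj sv]|Sv]; last by exists v.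
by rewrite -/v -sv//; exact: SV.
Qed.

End LebesgueOrthonormal.

(** * Orthogonal projections and principal angles *)

(** The field of scalars K stands for R or for R[i], with iota the embedding of
    the reals, so that one proof covers both cases. Where the two fields differ,
    namely in the existence of an eigenvector with a real eigenvalue, the fact is
    a hypothesis. *)
Section Angles.
Context {R : realType} {K : numFieldType} {theta : {rmorphism K -> K}}.
Variable iota : {rmorphism R -> K}.
Hypothesis iota_le : {mono iota : x y / x <= y}.
Hypothesis theta_iota : forall a, theta (iota a) = iota a.
Hypothesis ge0_iota : forall x : K, 0 <= x -> exists a, x = iota a.
Context {X : vectType K}.
Variable d : {dot X for theta}.
Hypothesis eigenvector : forall (T : 'End(X)) (V : {vspace X}), V != 0%VS ->
  {in V, forall v, T v \in V} -> {in V &, forall u v, d (T u) v = d u (T v)} ->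
  exists u a, [/\ u \in V, u != 0 & T u = iota a *: u].
Implicit Types (U V W : {vspace X}) (u v : X).

Lemma dotZl a u v : d (a *: u) v = a * d u v.
Proof. exact: linearZl_LR. Qed.

Lemma dotZr a u v : d u (iota a *: v) = iota a * d u v.
Proof. by rewrite linearZr_LR /= theta_iota. Qed.

Lemma dot_sqr v : exists a, 0 <= a /\ d v v = iota (a ^+ 2).
Proof.
have [b dvv] := ge0_iota (dot_ge0 d v); exists (Num.sqrt b); split=> //.
by rewrite sqr_sqrtr// -iota_le rmorph0 -dvv dot_ge0.
Qed.

Lemma unit_vector V v : v \in V -> v != 0 ->
  exists b, iota b *: v \in V /\ d (iota b *: v) (iota b *: v) = 1.
Proof.
move=> vV v0; have [a [_ dvv]] := dot_sqr v.
have a0 : a != 0.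
  by apply: contraNneq v0 => a0; rewrite -(dot_eq0 d) dvv a0 expr0n rmorph0.
exists a^-1; split; first by rewrite memvZ.
rewrite dotZl dotZr dvv -!rmorphM -[RHS](rmorph1 iota); congr (iota _).
by rewrite mulrA -invfM -expr2 mulVf// expf_neq0.
Qed.

(** Split off a unit eigenvector u and continue in its orthogonal complement
    within V, which T preserves because T is self-adjoint. *)
Lemma self_adjoint_basis (T : 'End(X)) V :
  {in V, forall v, T v \in V} -> {in V &, forall u v, d (T u) v = d u (T v)} ->
  exists2 e : seq X, orthonormal_basis_of d V e &
    {in e, forall u, exists a, T u = iota a *: u}.
Proof.
move: {2}(\dim V) (erefl (\dim V)) => n.
elim: n V => [|n IH] V dV TV Tsa.
  by exists [::] => //; apply: orthonormal_basisP => //; rewrite dV.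
have V0 : V != 0%VS by rewrite -dimv_eq0 dV.
have [v [a [vV v0 Tv]]] := eigenvector V0 TV Tsa.
have [b] := unit_vector vV v0; set u := iota b *: v => -[uV duu].
have Tu : T u = iota a *: u by rewrite linearZ /= Tv !scalerA mulrC.
pose V' := (V :&: orthov d <[u]>)%VS.
have V'V w : w \in V' -> w \in V by rewrite memv_cap => /andP[].
have V'u w : w \in V' -> d w u = 0.
  by rewrite memv_cap mem_orthov1 => /andP[_ /eqP].
have dV' : \dim V' = n.
  rewrite -(@eq_dim_orthov1 _ _ _ _ d u V) ?dV//.
  by apply/mem_orthovPn; exists u; rewrite ?[X in X != 0]duu ?oner_eq0.
have TV' : {in V', forall v, T v \in V'}.
  move=> w wV'; rewrite memv_cap mem_orthov1 TV ?V'V//=.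
  by rewrite (Tsa _ _ (V'V _ wV') uV) Tu dotZr V'u// mulr0.
have Tsa' : {in V' &, forall w w', d (T w) w' = d w (T w')}.
  by move=> w w' wV' w'V'; apply: Tsa; exact: V'V.
have [e eV' eT] := IH V' dV' TV' Tsa'.
exists (u :: e); last first.
  by move=> w /[!inE] /predU1P[->|/eT//]; exists a.
have eV'_mem w : w \in e -> w \in V' by exact: orthonormal_basis_mem eV'.
apply: orthonormal_basisP => /=.
- have /andP[_ /andP[e1 eo]] := eV'.
  rewrite /orthonormal /= e1 eo duu eqxx /ortho_rec /= !andbT.
  by apply/allP => w /eV'_mem/V'u/dot_sym0/eqP.
- by move=> w /[!inE] /predU1P[->//|/eV'_mem/V'V].
- by rewrite dV (orthonormal_basis_size eV') dV'.
Qed.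

(** Every orthonormal basis diagonalizes the identity, so this is a case of the
    spectral theorem above. *)
Lemma orthonormal_basis_exists V : exists e, orthonormal_basis_of d V e.
Proof.
have [||e eV _] := @self_adjoint_basis \1%VF V; last by exists e.
- by move=> v; rewrite lfunE.
- by move=> u v _ _; rewrite !lfunE.
Qed.

Lemma capv_orthov W : (W :&: orthov d W)%VS = 0%VS.
Proof.
apply/eqP; rewrite -subv0; apply/subvP => v; rewrite memv_cap memv0.
by move=> /andP[vW /mem_orthovP/(_ _ vW)/eqP]; rewrite dot_eq0.
Qed.

Lemma addv_orthov W : (W + orthov d W)%VS = fullv.
Proof.
apply/vspaceP => v; rewrite memvf.
have [e eW] := orthonormal_basis_exists W.
pose w := \sum_i d v (tnth (in_tuple e) i) *: tnth (in_tuple e) i.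
have eiW i : tnth (in_tuple e) i \in W.
  by apply: (orthonormal_basis_mem eW); exact: mem_tnth.
rewrite -(subrK w v) addrC memv_add//.
  by apply: memv_suml => i _; rewrite memvZ.
apply/mem_orthovP => u uW; rewrite linearBl; apply/eqP; rewrite subr_eq0.
rewrite (@orthonormal_basis_coord _ _ _ _ _ _ (in_tuple e) u eW uW).
rewrite !linear_sumr; apply/eqP/eq_bigr => i _; rewrite !linearZr_LR/=.
have /andP[_ eo] := eW.
by congr (_ * _); rewrite /w (@orthonormal_coord _ _ _ d _ (in_tuple e)).
Qed.

Local Notation proj W := (orthogonal_projection d W).

Lemma proj_mem W v : proj W v \in W.
Proof. exact: memv_pi. Qed.

Lemma dot_projl W v w : w \in W -> d (proj W v) w = d v w.
Proof.
move=> wW; have := @daddv_pi_add _ _ W (orthov d W) v (capv_orthov W).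
rewrite addv_orthov memvf => /(_ isT) {2}<-; rewrite linearDl/=.
by have /mem_orthovP -> := memv_pi (orthov d W) W v; rewrite ?addr0.
Qed.

Lemma dot_projr W v w : w \in W -> d w (proj W v) = d w v.
Proof. by move=> wW; rewrite dot_sym dot_projl// -dot_sym. Qed.

Lemma dot_proj_le W v : d (proj W v) (proj W v) <= d v v.
Proof.
have ortho : d (v - proj W v) (proj W v) = 0.
  by rewrite linearBl/= dot_projl ?proj_mem// subrr.
by have := hnormDd ortho; rewrite subrK => ->; rewrite lerDr dot_ge0.
Qed.

Lemma orthonormal_extend W s : orthonormal d s -> {subset s <= W} ->
  exists s', orthonormal_basis_of d W (s ++ s').
Proof.
move=> so sW; have [s' s'W] := orthonormal_basis_exists (W :&: orthov d << s >>).
have s'P w : w \in s' -> w \in W /\ w \in orthov d << s >>.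
  by move=> /(orthonormal_basis_mem s'W); rewrite memv_cap => /andP.
have sWs : (<< s >> <= W)%VS by exact/span_subvP.
exists s'; apply: orthonormal_basisP.
- apply/orthonormal_memP; have /andP[_ /orthonormal_memP[us' s'o]] := s'W.
  have /orthonormal_memP[us so'] := so.
  have s's u v : u \in s' -> v \in s -> d u v = 0.
    move=> /s'P[_ /mem_orthovP us0] vs; apply: us0; exact: memv_span.
  have disj u v : u \in s' -> v \in s -> u != v.
    move=> us1 vs1; apply/eqP => uv; have := s's _ _ us1 vs1.
    by rewrite uv so'// eqxx => /eqP; rewrite oner_eq0.
  split; first rewrite cat_uniq us us' andbT /=.
    by apply/hasPn => u us1; apply/negP => /(disj _ _ us1); rewrite eqxx.
  move=> u v; rewrite !mem_cat => /orP[us1|us1] /orP[vs1|vs1].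
  - exact: so'.
  - by rewrite (dot_sym0 (s's _ _ vs1 us1)) eq_sym (negbTE (disj _ _ vs1 us1)).
  - by rewrite s's// (negbTE (disj _ _ us1 vs1)).
  - exact: s'o.
- by move=> w; rewrite mem_cat => /orP[/sW//|/s'P[]].
have -> : W = (<< s >> + (W :&: orthov d << s >>))%VS.
  by rewrite [X in (_ + X)%VS]capvC vspace_modl// addv_orthov capfv.
rewrite size_cat; have /andP[/span_basis <- _] := s'W.
by rewrite -span_cat -size_cat dim_span.
Qed.

Lemma acos_nonincreasing (x y : R) : -1 <= x <= 1 -> -1 <= y <= 1 -> x <= y ->
  acos y <= acos x.
Proof.
move=> x1 y1; rewrite !leNgt; apply: contra => xy.
rewrite -(acosK (x := y)) ?in_itv// -(acosK (x := x)) ?in_itv//.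
by rewrite ltr_cos// in_itv/= acos_ge0// acos_lepi.
Qed.


Section PrincipalAngles.
Variables V W : {vspace X}.

Let T := (proj V \o proj W)%VF.

(* T is the compression to V of the projection to W; by the identity below it
   is self-adjoint on V, and <P u, P v> is diagonal in its eigenbasis. *)
Let dotT : {in V, forall v u, d (T u) v = d (proj W u) (proj W v)}.
Proof. by move=> v vV u; rewrite comp_lfunE dot_projl// dot_projr// proj_mem. Qed.

(** The numbers N u are the lengths of the projections of the basis vectors to
    W, that is, the cosines of the principal angles; sorting them in decreasing
    order makes the angles increase. *)
Lemma sorted_singular_basis : exists (e : seq X) (N : X -> R),
  [/\ orthonormal_basis_of d V e,
      {in e &, forall u v, d (proj W u) (proj W v) =
         if u == v then iota (N u ^+ 2) else 0},
      forall u, 0 <= N u & sorted (fun u v => N v <= N u) e].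
Proof.
have [N NP] := choice (fun v => dot_sqr (proj W v)).
have TV : {in V, forall v, T v \in V}.
  by move=> v _; rewrite comp_lfunE proj_mem.
have Tsa : {in V &, forall u v, d (T u) v = d u (T v)}.
  by move=> u v uV vV; rewrite dotT// dot_sym -dotT// -dot_sym.
have [e eV eT] := self_adjoint_basis TV Tsa.
pose leN u v := N v <= N u; exists (sort leN e), N.
have pe : perm_eq e (sort leN e) by rewrite perm_sym perm_sort.
have eV' : orthonormal_basis_of d V (sort leN e).
  by rewrite /orthonormal_basis_of -(perm_basis _ pe) -(perm_orthonormal _ pe).
split=> //.
- move=> u v; rewrite !mem_sort => ue ve.
  have [<-|uv] := eqVneq u v; first by have [] := NP u.
  have vV := orthonormal_basis_mem eV ve.
  have [a Tu] := eT u ue; rewrite -dotT// Tu dotZl.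
  have /andP[_ /orthonormal_memP[_ ->//]] := eV.
  by rewrite (negbTE uv) mulr0.
- by move=> u; have [] := NP u.
- by apply: sort_sorted => u v; exact: le_total.
Qed.

(** The projections of the first r basis vectors of V are nonzero and orthogonal;
    once normalized they start the basis f of W. The remaining basis vectors of
    V project to 0, so any completion f2 of the basis of W will do, with angles
    acos 0. *)
Lemma principal_angles_exist :
  exists t, @is_principal_angles R K theta X iota d V W t.
Proof.
have [e0 [N [e0V Ne N0 Nsorted]]] := sorted_singular_basis.
have leN_trans : transitive (fun u v => N v <= N u).
  by move=> v u w uv vw; exact: le_trans vw uv.
have leN_refl : reflexive (fun u v => N v <= N u) by move=> u; exact: lexx.
pose p := \dim V; have e0size : size e0 = p by rewrite (orthonormal_basis_size e0V).
pose e := Tuple (introT eqP e0size).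
have eE i : tnth e i = e0`_i by rewrite (tnth_nth 0).
have e0i i : (i < p)%N -> e0`_i \in e0 by move=> ip; rewrite mem_nth// e0size.
have dP i j : (i < p)%N -> (j < p)%N -> d (proj W e0`_i) (proj W e0`_j) =
    if i == j then iota (N e0`_i ^+ 2) else 0.
  move=> ip jp; rewrite Ne ?e0i// nth_uniq ?e0size//.
  by have /andP[_ /orthonormal_memP[]] := e0V.
(* Lengths decrease along e0, so the zero lengths are exactly those from r on. *)
pose r := find (fun u => N u == 0) e0.
have rp : (r <= p)%N by rewrite -e0size find_size.
have Nr i : (i < r)%N -> N e0`_i != 0.
  by move=> ir; have /= -> := @before_find _ 0 (fun u => N u == 0) e0 i ir.
have Nr0 i : (r <= i < p)%N -> N e0`_i = 0.
  move=> /andP[ri ip]; apply: le_anti; rewrite N0 andbT.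
  have rp' := leq_ltn_trans ri ip.
  have /eqP <- : N e0`_r == 0.
    by apply: (@nth_find _ 0 (fun u => N u == 0)); rewrite has_find e0size.
  by apply: (sorted_leq_nth leN_trans leN_refl 0 Nsorted); rewrite ?inE ?e0size.
pose f1 := [seq iota (N u)^-1 *: proj W u | u <- take r e0].
have f1size : size f1 = r by rewrite size_map size_takel// e0size.
have f1E i : (i < r)%N -> f1`_i = iota (N e0`_i)^-1 *: proj W e0`_i.
  move=> ir; rewrite (nth_map 0) ?nth_take//.
  by rewrite size_takel// e0size.
have f1o : orthonormal d f1.
  apply/orthonormal_nthP => i j; rewrite f1size => ir jr.
  rewrite !f1E// dotZl dotZr dP; do ?exact: leq_trans rp.
  case: eqVneq => [<-|_]; last by rewrite !mulr0.
  rewrite -!rmorphM -[RHS](rmorph1 iota); congr (iota _).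
  by rewrite mulrA -invfM -expr2 mulVf// expf_neq0// Nr.
have f1W : {subset f1 <= W}.
  by move=> _ /mapP[u _ ->]; rewrite memvZ// proj_mem.
have [f2 fW] := orthonormal_extend f1o f1W.
pose q := \dim W.
have fsize : size (f1 ++ f2) = q by rewrite (orthonormal_basis_size fW).
pose f := Tuple (introT eqP fsize).
have rq : (r <= q)%N by rewrite -fsize size_cat f1size leq_addr.
have fE i : (i < r)%N -> (f1 ++ f2)`_i = f1`_i by rewrite nth_cat f1size => ->.
pose m := minn p q.
(* Projections do not increase length, so acos is applied within its domain. *)
have N1 i : (i < p)%N -> -1 <= N e0`_i <= 1.
  move=> ip; rewrite (le_trans _ (N0 _)) ?lerN10//=.
  rewrite -(@ler_pXn2r _ 2) ?nnegrE ?N0 ?ler01// expr1n -iota_le rmorph1.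
  have := dot_proj_le W e0`_i; rewrite dP// eqxx.
  by have /andP[_ /orthonormal_nthP ->] := e0V; rewrite ?e0size// eqxx.
pose t := [tuple acos (N e0`_(i : 'I_m)) | i < m].
have tE i : (i < m)%N -> t`_i = acos (N e0`_i).
  by move=> im; rewrite -(tnth_nth 0 t (Ordinal im)) tnth_mktuple.
have mp i : (i < m)%N -> (i < p)%N by move=> im; apply: leq_trans im (geq_minl _ _).
exists t, e, f; split.
- exact: e0V.
- exact: fW.
- apply/(sortedP 0) => i; rewrite size_tuple => im; have im' := ltnW im.
  rewrite !tE//; apply: acos_nonincreasing; rewrite ?N1 ?mp//.
  by apply: (sorted_leq_nth leN_trans leN_refl 0 Nsorted); rewrite ?inE ?e0size ?mp.
- move=> i; rewrite tnth_mktuple acos_ge0 ?N1 ?mp//=.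
  by rewrite -acos0 acos_nonincreasing// ?N1 ?mp// lerN10 ler01.
move=> i j; rewrite eE (tnth_nth 0) /=.
have fjW : (f1 ++ f2)`_j \in W.
  by apply: (orthonormal_basis_mem fW); rewrite mem_nth// fsize.
rewrite -(dot_projl _ fjW); have [ir|ri] := ltnP i r; last first.
  have Ni : N e0`_i = 0 by apply: Nr0; rewrite ri/= ltn_ord.
  have -> : proj W e0`_i = 0.
    apply/eqP; rewrite -(dot_eq0 d) dP// eqxx Ni expr0n rmorph0 eqxx//.
  rewrite linear0l; case: eqP => // ij.
  have im : (i < m)%N by rewrite /m leq_min ltn_ord ij ltn_ord.
  by rewrite tE// acosK ?Ni ?rmorph0// in_itv/= lerN10 ler01.
have -> : proj W e0`_i = iota (N e0`_i) *: (f1 ++ f2)`_i.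
  rewrite fE// f1E// scalerA -rmorphM mulfV ?rmorph1 ?scale1r//.
  exact: Nr.
have im : (i < m)%N by rewrite /m leq_min ltn_ord (leq_trans ir rq).
have /andP[_ /orthonormal_nthP fo] := fW.
rewrite dotZl fo ?fsize ?(leq_trans ir rq)//.
case: eqP => _; last by rewrite mulr0.
by rewrite mulr1 tE// acosK// in_itv/= N1// mp.
Qed.

End PrincipalAngles.

(** The components of the projection of e_i along f_j are <e_i, f_j>, so that
    projection is cos (t i) *: f_i, and 0 once i reaches the dimension of W. *)
Lemma proj_principal_basis V W t (e : (\dim V).-tuple X) (f : (\dim W).-tuple X) :
  orthonormal_basis_of d W f ->
  (forall (i : 'I_(\dim V)) (j : 'I_(\dim W)), d (tnth e i) (tnth f j) =
     if i == j :> nat then iota (cos (t i)) else 0) ->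
  forall i j, d (proj W (tnth e i)) (proj W (tnth e j)) =
    if i == j then iota ((if (i < \dim W)%N then cos (t i) else 0) ^+ 2) else 0.
Proof.
move=> fW ef.
have projE i : proj W (tnth e i) =
    if insub (i : nat) is Some k then iota (cos (t i)) *: tnth f k else 0.
  rewrite (orthonormal_basis_coord fW (proj_mem W (tnth e i))).
  have fkW k : tnth f k \in W by apply: (orthonormal_basis_mem fW); exact: mem_tnth.
  case: insubP => [k ki kE|ki].
    rewrite (bigD1 k)//= big1 ?addr0 => [|l lk].
      by rewrite dot_projl// ef kE eqxx.
    rewrite dot_projl// ef -kE eq_sym -val_eqE in lk *.
    by rewrite (negbTE lk) scale0r.
  rewrite big1// => k _; rewrite dot_projl// ef; case: eqP => [ik|_].
    by move: ki; rewrite ik ltn_ord.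
  by rewrite scale0r.
have /andP[_ /orthonormal_nthP fo] := fW.
move=> i j; rewrite !projE; case: insubP => [k ki kE|ki]; last first.
  by rewrite linear0l (negbTE ki) expr0n rmorph0 if_same.
rewrite ki; case: insubP => [l lj lE|lj]; last first.
  rewrite linear0r; case: eqP => // ij; by rewrite -ij ki in lj.
rewrite dotZl dotZr !(tnth_nth 0) fo ?size_tuple// kE lE val_eqE.
by case: eqVneq => [->|_]; rewrite ?mulr0// mulr1 -rmorphM.
Qed.

(** When V is larger than W, some c i is 0 and so is the product, in agreement
    with the Grassmann angle pi / 2; when V is 0 the product is empty and the
    angle is 0. *)
Lemma principal_basis V W : exists (e : (\dim V).-tuple X) (c : 'I_(\dim V) -> R),
  [/\ orthonormal_basis_of d V e, forall i, 0 <= c i,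
      forall i j, d (proj W (tnth e i)) (proj W (tnth e j)) =
        if i == j then iota (c i ^+ 2) else 0 &
      \prod_i c i = cos (Grassmann_angle iota d V W)].
Proof.
have /(@xgetPex _ [tuple of nseq _ 0]) := @principal_angles_exist V W.
rewrite -/(principal_angles iota d V W).
set t := principal_angles iota d V W => -[e [f [eV fW tsorted trange ef]]].
(* Beyond the last angle t`_i is the default 0, whose cosine is 1: the test on i
   is what makes c vanish there. *)
exists e, (fun i : 'I__ => if (i < \dim W)%N then cos t`_i else 0); split=> //.
- move=> i; case: ifP => // iW.
  have im : (i < minn (\dim V) (\dim W))%N by rewrite leq_min ltn_ord.
  rewrite -(tnth_nth 0 t (Ordinal im)); apply: cos_ge0_pihalf.
  have /andP[t0 ->] := trange (Ordinal im); rewrite andbT (le_trans _ t0)//.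
  by rewrite oppr_le0 divr_ge0// pi_ge0.
- exact: (@proj_principal_basis V W (fun i => t`_i) e f fW ef).
rewrite /Grassmann_angle -!dimv_eq0 -/t.
have [V0|V0] := eqVneq (\dim V) 0%N.
  by rewrite cos0 big1// => i _; have := ltn_ord i; rewrite [X in (_ < X)%N]V0.
have small : (\dim W < \dim V)%N ->
    \prod_(i < \dim V) (if (i < \dim W)%N then cos t`_i else 0) = 0.
  by move=> WV; rewrite (bigD1 (Ordinal WV))//= ltnn mul0r.
have [W0|W0] := eqVneq (\dim W) 0%N.
  by rewrite cos_pihalf small// W0 lt0n.
case: ifPn => [VW|]; last by rewrite -ltnNge => /small ->; rewrite cos_pihalf.
have -> : \prod_(i < \dim V) (if (i < \dim W)%N then cos t`_i else 0) =
          \prod_(s <- t) cos s.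
  have st : size t = \dim V by rewrite size_tuple (minn_idPl VW).
  rewrite (big_nth 0) st big_mkord.
  by apply: eq_bigr => i _; rewrite (leq_trans (ltn_ord i) VW).
have cos01 s : s \in t -> 0 <= cos s <= 1.
  move=> /tnthP[i ->]; rewrite cos_le1 andbT; apply: cos_ge0_pihalf.
  have /andP[t0 ->] := trange i; rewrite andbT (le_trans _ t0)//.
  by rewrite oppr_le0 divr_ge0// pi_ge0.
have prod0 : 0 <= \prod_(s <- t) cos s.
  by rewrite big_seq prodr_ge0// => s /cos01/andP[].
rewrite acosK// in_itv/= (le_trans (lerN10 _))//= big_seq.
exact: numdomain.Num.Theory.prodr_ile1.
Qed.

End Angles.

(** * Eigenvectors of self-adjoint operators *)

Section MatrixOnSubspace.
Context {K : fieldType} {X : vectType K}.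
Variables (T : 'End(X)) (V : {vspace X}).

Definition vec_of_coords (z : 'rV[K]_(\dim V)) : X :=
  \sum_i z 0 i *: (vbasis V)`_i.

Definition subspace_mx : 'M[K]_(\dim V) :=
  \matrix_(i, j) coord (vbasis V) j (T (vbasis V)`_i).

Lemma vec_of_coords_mem z : vec_of_coords z \in V.
Proof.
by apply: memv_suml => i _; rewrite memvZ// vbasis_mem// mem_nth ?size_tuple.
Qed.

Lemma vec_of_coords_eq0 z : vec_of_coords z = 0 -> z = 0.
Proof.
have /freeP fV := basis_free (vbasisP V).
by move=> /(fV (z 0)) z0; apply/rowP => i; rewrite z0 mxE.
Qed.

Lemma vec_of_coords_linear a b z w :
  vec_of_coords (a *: z + b *: w) = a *: vec_of_coords z + b *: vec_of_coords w.
Proof.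
rewrite /vec_of_coords !scaler_sumr -big_split; apply: eq_bigr => i _ /=.
by rewrite !mxE scalerDl !scalerA.
Qed.

Lemma vec_of_coords_mulmx z : {in V, forall v, T v \in V} ->
  T (vec_of_coords z) = vec_of_coords (z *m subspace_mx).
Proof.
move=> TV; rewrite linear_sum.
transitivity (\sum_i \sum_j (z 0 i * subspace_mx i j) *: (vbasis V)`_j).
  apply: eq_bigr => i _; rewrite linearZ/=.
  have biV : T (vbasis V)`_i \in V.
    by apply: TV; rewrite vbasis_mem// mem_nth ?size_tuple.
  rewrite (coord_vbasis biV) scaler_sumr; apply: eq_bigr => j _.
  by rewrite scalerA mxE.
rewrite exchange_big; apply: eq_bigr => j _.
by rewrite mxE -scaler_suml.
Qed.

End MatrixOnSubspace.

Section Eigenvectors.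
Context {R : realType}.

(** Self-adjointness forces the eigenvalue to equal its conjugate. *)
Lemma complex_eigenvector (X : vectType R[i]) (d : {dot X for @Num.conj R[i]})
    (T : 'End(X)) (V : {vspace X}) : V != 0%VS ->
  {in V, forall v, T v \in V} -> {in V &, forall u v, d (T u) v = d u (T v)} ->
  exists u a, [/\ u \in V, u != 0 & T u = real_complex R a *: u].
Proof.
rewrite -dimv_eq0 -lt0n => V0 TV Tsa.
have [l /eigenvalueP[z zM z0]] := eigenvalue_closed (subspace_mx T V) V0.
pose u := vec_of_coords z; have uV : u \in V := vec_of_coords_mem z.
have u0 : u != 0 by apply: contraNneq z0 => /vec_of_coords_eq0 ->.
have Tu : T u = l *: u.
  rewrite vec_of_coords_mulmx// zM -[l *: z]addr0 -(scale0r 0).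
  by rewrite vec_of_coords_linear scale0r addr0.
have duu : d u u != 0 by rewrite (dot_eq0 d u).
have /complex_realP[a la] : l \is Num.real.
  apply/CrealP; have := Tsa u u uV uV.
  by rewrite Tu linearZl_LR linearZr_LR/= => /(mulIf duu).
by exists u, a; rewrite Tu la.
Qed.

(** Over the reals, take a complex eigenvector x + i y of the matrix of T with
    eigenvalue a + i b. Then T x = a x - b y and T y = b x + a y, and symmetry
    <T x, y> = <x, T y> reads b (|x|^2 + |y|^2) = 0. Hence b = 0, and whichever of
    x and y is nonzero is a real eigenvector. *)
Lemma real_eigenvector (X : vectType R) (d : {dot X for idfun})
    (T : 'End(X)) (V : {vspace X}) : V != 0%VS ->
  {in V, forall v, T v \in V} -> {in V &, forall u v, d (T u) v = d u (T v)} ->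
  exists u a, [/\ u \in V, u != 0 & T u = a *: u].
Proof.
rewrite -dimv_eq0 -lt0n => V0 TV Tsa; set M := subspace_mx T V.
have [l /eigenvalueP[z zM z0]] :=
  eigenvalue_closed (map_mx (real_complex R) M) V0.
pose x := map_mx (@complex.Re R) z; pose y := map_mx (@complex.Im R) z.
pose a := complex.Re l; pose b := complex.Im l.
have zMj j : (z *m map_mx (real_complex R) M) 0 j = l * z 0 j.
  by rewrite zM mxE.
have xM : x *m M = a *: x + (- b) *: y.
  apply/rowP => j; have /(congr1 (@complex.Re R)) := zMj j.
  rewrite !mxE raddf_sum /= => xMj; transitivity (complex.Re (l * z 0 j)).
    rewrite -xMj; apply: eq_bigr => i _; rewrite !mxE.
    by case: (z 0 i) => u v /=; rewrite mulr0 subr0.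
  by rewrite /a /b; case: (l) => ? ?; case: (z 0 j) => ? ? /=; rewrite mulNr.
have yM : y *m M = b *: x + a *: y.
  apply/rowP => j; have /(congr1 (@complex.Im R)) := zMj j.
  rewrite !mxE raddf_sum /= => yMj; transitivity (complex.Im (l * z 0 j)).
    rewrite -yMj; apply: eq_bigr => i _; rewrite !mxE.
    by case: (z 0 i) => u v /=; rewrite mulr0 add0r.
  by rewrite /a /b; case: (l) => ? ?; case: (z 0 j) => ? ? /=; rewrite addrC.
have Tu := vec_of_coords_mulmx x TV; have Tv := vec_of_coords_mulmx y TV.
rewrite xM vec_of_coords_linear in Tu; rewrite yM vec_of_coords_linear in Tv.
have xV := vec_of_coords_mem x; have yV := vec_of_coords_mem y.
have xy0 : (vec_of_coords x != 0) || (vec_of_coords y != 0).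
  rewrite -negb_and; apply: contraNN z0.
  move=> /andP[/eqP/vec_of_coords_eq0 x0 /eqP/vec_of_coords_eq0 y0].
  apply/eqP/rowP => j; move/rowP/(_ j): x0; move/rowP/(_ j): y0; rewrite !mxE.
  by case: (z 0 j) => ? ? /= -> ->.
have dxy_gt0 : 0 < d (vec_of_coords x) (vec_of_coords x) +
                   d (vec_of_coords y) (vec_of_coords y).
  case/orP: xy0 => [x0|y0].
    by rewrite ltr_wpDr ?dot_ge0//; exact: neq0_dnorm_gt0.
  by rewrite ltr_wpDl ?dot_ge0//; exact: neq0_dnorm_gt0.
have b0 : b = 0.
  have := Tsa _ _ xV yV; rewrite Tu Tv linearDl linearDr/=.
  rewrite !linearZl_LR !linearZr_LR/= => /eqP.
  rewrite addrC (inj_eq (addIr _)) mulNr eq_sym -addr_eq0 -mulrDr mulf_eq0.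
  by rewrite [X in _ || X]gt_eqF// orbF => /eqP.
move: Tu Tv; rewrite b0 oppr0 !scale0r addr0 add0r => Tu Tv.
case/orP: xy0 => [x0|y0]; first by exists (vec_of_coords x), a.
by exists (vec_of_coords y), a.
Qed.

End Eigenvectors.

(** * Restriction of scalars *)

Section Realification.
Context {R : realType} {X : vectType R[i]}.
Variable d : {dot X for @Num.conj R[i]}.
Implicit Types (V : {vspace X}).

(** The same function on the same carrier; the constant gives the real-linear
    structure below something to attach to. *)
Definition realify_fun (f : 'End(X)) : realification X -> realification X := f.

Lemma realify_fun_linear (f : 'End(X)) : linear (realify_fun f).
Proof. move=> a x y; exact: (linearP f). Qed.

HB.instance Definition _ (f : 'End(X)) := GRing.isLinear.Build R
  (realification X) (realification X) *:%R (realify_fun f)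
  (realify_fun_linear f).

Definition realify_basis n (e : n.-tuple X) : (n + n).-tuple (realification X) :=
  [tuple of [seq (x : realification X) | x <- e] ++
            [seq ('i%C *: x : realification X) | x <- e]].

Definition twice n (c : 'I_n -> R) (i : 'I_(n + n)) : R :=
  match fintype.split i with inl j => c j | inr j => c j end.

Lemma prod_twice n (c : 'I_n -> R) :
  \prod_i twice c i = (\prod_i c i) ^+ 2.
Proof.
rewrite big_split_ord expr2; congr (_ * _); apply: eq_bigr => i _;
  by rewrite /twice ?(unsplitK (inl i)) ?(unsplitK (inr i)).
Qed.

(** For vectors u, v with real <u, v>, both <u, i v> and <i u, v> are purely
    imaginary, and <i u, i v> = <u, v>: so e and i e contribute two orthogonal
    copies of the same Gram matrix. *)
Lemma Re_dot_realify_basis n (e : n.-tuple X) (f : 'End(X)) (c : 'I_n -> R) :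
  (forall i j, d (f (tnth e i)) (f (tnth e j)) =
     if i == j then real_complex R (c i ^+ 2) else 0) ->
  forall i j, Re_dot d (realify_fun f (tnth (realify_basis e) i))
                       (realify_fun f (tnth (realify_basis e) j)) =
     if i == j then twice c i ^+ 2 else 0.
Proof.
move=> fe i j.
have eE k : tnth (realify_basis e) (unsplit (inl k)) = tnth e k.
  by rewrite tnth_lshift tnth_map.
have ieE k : tnth (realify_basis e) (unsplit (inr k)) = ('i%C *: tnth e k : X).
  by rewrite tnth_rshift tnth_map.
have fi x : realify_fun f ('i%C *: x : X) = ('i%C *: f x : X).
  by rewrite /realify_fun linearZ.
rewrite -(splitK i) -(splitK j) /twice !unsplitK (can_eq (@unsplitK n n)).
rewrite /Re_dot.
case: (fintype.split i) => k; case: (fintype.split j) => l;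
  rewrite ?eE ?ieE ?fi ?linearZl_LR ?linearZr_LR /= fe.
- by rewrite -[inl k == inl l]/(k == l); case: (k == l).
- by case: (k == l) => /=; ring.
- by case: (k == l) => /=; ring.
- by rewrite -[inr k == inr l]/(k == l); case: (k == l) => /=; ring.
Qed.

Lemma realify_basisP V (e : (\dim V).-tuple X) : orthonormal_basis_of d V e ->
  orthonormal_basis_of (Re_dot d) (realify_vspace V) (realify_basis e).
Proof.
move=> eV; apply: orthonormal_basisP.
- apply: orthonormal_tnth => i j.
  have idE x : realify_fun \1%VF x = x by rewrite /realify_fun lfunE.
  transitivity (Re_dot d (realify_fun \1%VF (tnth (realify_basis e) i))
                         (realify_fun \1%VF (tnth (realify_basis e) j))).
    by rewrite !idE.
  rewrite (@Re_dot_realify_basis _ e _ (fun=> 1)) => [|k l].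
    by rewrite /twice; case: eqP => // _; case: fintype.split => _; rewrite expr1n.
  rewrite !lfunE; have /andP[_ /orthonormal_nthP eo] := eV.
  rewrite !(tnth_nth 0) eo ?size_tuple// expr1n rmorph1 val_eqE.
  by case: eqP.
- move=> x; rewrite mem_cat => /orP[/mapP[u ue ->]|/mapP[u ue ->]].
    by rewrite mem_realify_vspace (orthonormal_basis_mem eV).
  by rewrite mem_realify_vspace memvZ// (orthonormal_basis_mem eV).
- rewrite size_tuple (leq_trans (dim_span _))//.
  by rewrite size_cat !size_map !size_tuple.
Qed.

End Realification.

Theorem theorem3p16 (R : realType) :
  (forall (X : vectType R) (d : {dot X for idfun}) (V W : {vspace X})
      (S : set X),
    S `<=` [set` V] -> lebesgue_measurable_in d V S ->
    lebesgue_dim d (\dim V) (orthogonal_projection d W @` S) =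
    (lebesgue_dim d (\dim V) S * (cos (Grassmann_angle idfun d V W))%:E)%E)
  /\
  (forall (X : vectType R[i]) (d : {dot X for @Num.conj R[i]})
      (V W : {vspace X}) (S : set X),
    S `<=` [set` V] ->
    lebesgue_measurable_in (Re_dot d) (realify_vspace V) S ->
    lebesgue_dim (Re_dot d) (2 * \dim V) (orthogonal_projection d W @` S) =
    (lebesgue_dim (Re_dot d) (2 * \dim V) S *
      (cos (Grassmann_angle (real_complex R) d V W) ^+ 2)%:E)%E).
Proof.
split=> X d V W S SV _.
  have [|//|x _|T U U0 TU Tsa|e [c [eV c0 Pe <-]]] :=
    @principal_basis R R idfun idfun _ _ _ X d _ V W => //.
  - by exists x.
  - exact: real_eigenvector Tsa.
  exact: (lebesgue_dim_image eV c0 Pe SV).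
have [x y|a|x x0|T U U0 TU Tsa|e [c [eV c0 Pe <-]]] :=
  @principal_basis R R[i] (@Num.conj R[i]) (real_complex R) _ _ _ X d _ V W.
- exact: lecR.
- by apply: conj_Creal; rewrite complex_real.
- by have /complex_realP := ger0_real x0.
- exact: complex_eigenvector Tsa.
rewrite mul2n -addnn -prod_twice.
have fE x : linfun (realify_fun (orthogonal_projection d W)) x =
    orthogonal_projection d W x by rewrite lfunE.
rewrite (_ : _ @` S =
    linfun (realify_fun (orthogonal_projection d W)) @` S :> set (realification X)).
  apply: (lebesgue_dim_image (realify_basisP eV)) => [i|i j|].
  - by rewrite /twice; case: fintype.split.
  - by rewrite !lfunE; exact: Re_dot_realify_basis.
  - by move=> x /SV xV /=; rewrite mem_realify_vspace.
by apply/eq_imagel => x _; rewrite fE.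
Qed.
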